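(* For the non-T8 network, the linear coding capacity is at most $28/29$ over any finite field alphabet of characteristic equal to $3$. The linear coding capacity of the non-T8 network over any finite field alphabet of characteristic not $3$, and the coding capacity of the non-T8 network, are all equal to $1$.
   Context: The non-T8 network has four source messages $A,B,C,D$. Its coding constraints are as follows. Let $\mathcal{A}$ be a finite alphabet with at least two elements and $k,n$ positive integers. Each message is an arbitrary vector in $\mathcal{A}^k$, and each network edge carries a vector in $\mathcal{A}^n$. There are four coding edges, carrying vectors $W,X,Y,Z\in\mathcal{A}^n$: - edge $(n_1,n_2)$ carries $W$, a function of the messages $B,C,D$; - edge $(n_3,n_4)$ carries $X$, a function of the messages $A,C,D$; - edge $(n_5,n_6)$ carries $Y$, a function of the messages $A,B,D$; - edge $(n_7,n_8)$ carries $Z$, a function of the messages $A,B,C$. There are seven demand nodes, each of which must recover its demanded message, for all message values, as a function of its inputs: - $n_9$ has inputs $B,W,X$ and demands $A$; - $n_{10}$ has inputs $A,W,Y$ and demands $C$; - $n_{11}$ has inputs $C,X,Y$ and demands $B$; - $n_{12}$ has inputs $A,W,Z$ and demands $D$; - $n_{13}$ has inputs $D,X,Z$ and demands $B$; - $n_{14}$ has inputs $D,Y,Z$ and demands $C$; - $n_{15}$ has inputs $W,X,Y,Z$ and demands $A$. A $(k,n)$-coding solution over $\mathcal{A}$ is a choice of the four edge functions and seven decoding functions such that every demand is met for all $(A,B,C,D)\in(\mathcal{A}^k)^4$. The coding capacity is $\sup\{k/n : \text{there exists a } (k,n)\text{-coding solution}\}$. If the alphabet is a finite field $F$, a solution is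 linear if all edge and decoding functions are $F$-linear (linear combinations of the input vectors with matrix coefficients over $F$); the linear coding capacity over $F$ is $\sup\{k/n : \text{there exists a linear } (k,n)\text{-coding solution over } F\}$. *)

(* Defs.v *)
From mathcomp Require Import all_boot all_order all_algebra.
From mathcomp Require Import all_classical all_reals ereal.

Set Implicit Arguments.
Unset Strict Implicit.
Unset Printing Implicit Defensive.

Import Order.TTheory GRing.Theory Num.Theory.

Local Open Scope ring_scope.
Local Open Scope classical_set_scope.

(* The messages A, B, C, D and the edge vectors W, X, Y, Z are row vectors in
   'rV[T]_k and 'rV[T]_n.  The arguments of each function are listed in
   alphabetical order, messages before edge vectors; a field [decode_i] is the
   decoding function of the demand node n_i. *)
Record nonT8_code (T : Type) (k n : nat) := NonT8Code {
  edgeW : 'rV[T]_k -> 'rV[T]_k -> 'rV[T]_k -> 'rV[T]_n;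
  edgeX : 'rV[T]_k -> 'rV[T]_k -> 'rV[T]_k -> 'rV[T]_n;
  edgeY : 'rV[T]_k -> 'rV[T]_k -> 'rV[T]_k -> 'rV[T]_n;
  edgeZ : 'rV[T]_k -> 'rV[T]_k -> 'rV[T]_k -> 'rV[T]_n;
  decode9 : 'rV[T]_k -> 'rV[T]_n -> 'rV[T]_n -> 'rV[T]_k;
  decode10 : 'rV[T]_k -> 'rV[T]_n -> 'rV[T]_n -> 'rV[T]_k;
  decode11 : 'rV[T]_k -> 'rV[T]_n -> 'rV[T]_n -> 'rV[T]_k;
  decode12 : 'rV[T]_k -> 'rV[T]_n -> 'rV[T]_n -> 'rV[T]_k;
  decode13 : 'rV[T]_k -> 'rV[T]_n -> 'rV[T]_n -> 'rV[T]_k;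
  decode14 : 'rV[T]_k -> 'rV[T]_n -> 'rV[T]_n -> 'rV[T]_k;
  decode15 : 'rV[T]_n -> 'rV[T]_n -> 'rV[T]_n -> 'rV[T]_n -> 'rV[T]_k
}.

Definition is_solution (T : Type) (k n : nat) (s : nonT8_code T k n) : Prop :=
  forall A B C D : 'rV[T]_k,
    let W := edgeW s B C D in
    let X := edgeX s A C D in
    let Y := edgeY s A B D in
    let Z := edgeZ s A B C in
    [/\ decode9 s B W X = A,
        decode10 s A W Y = C,
        decode11 s C X Y = B,
        decode12 s A W Z = D &
     [/\ decode13 s D X Z = B,
        decode14 s D Y Z = C &
        decode15 s W X Y Z = A]].

Definition linear3 (F : fieldType) (a b c m : nat)
    (f : 'rV[F]_a -> 'rV[F]_b -> 'rV[F]_c -> 'rV[F]_m) : Prop :=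
  exists (M1 : 'M[F]_(a, m)) (M2 : 'M[F]_(b, m)) (M3 : 'M[F]_(c, m)),
    forall x y z, f x y z = x *m M1 + y *m M2 + z *m M3.

Definition linear4 (F : fieldType) (a b c d m : nat)
    (f : 'rV[F]_a -> 'rV[F]_b -> 'rV[F]_c -> 'rV[F]_d -> 'rV[F]_m) : Prop :=
  exists (M1 : 'M[F]_(a, m)) (M2 : 'M[F]_(b, m))
         (M3 : 'M[F]_(c, m)) (M4 : 'M[F]_(d, m)),
    forall x y z t, f x y z t = x *m M1 + y *m M2 + z *m M3 + t *m M4.

Definition is_linear (F : fieldType) (k n : nat) (s : nonT8_code F k n) : Prop :=
  [/\ [/\ linear3 (edgeW s), linear3 (edgeX s),
          linear3 (edgeY s) & linear3 (edgeZ s)],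
      [/\ linear3 (decode9 s), linear3 (decode10 s) & linear3 (decode11 s)],
      [/\ linear3 (decode12 s), linear3 (decode13 s) & linear3 (decode14 s)] &
      linear4 (decode15 s)].

Definition has_solution (T : Type) (k n : nat) : Prop :=
  exists s : nonT8_code T k n, is_solution s.

Definition has_linear_solution (F : fieldType) (k n : nat) : Prop :=
  exists s : nonT8_code F k n, is_solution s /\ is_linear s.

(* The suprema are taken in the extended reals, since the real-valued [sup]
   takes the default value 0 on sets that are empty or not bounded above. *)
Definition coding_capacity (R : realType) (T : finType) : \bar R :=
  ereal_sup [set r | exists k n : nat,
    [/\ (0 < k)%N, (0 < n)%N, has_solution T k n & r = (k%:R / n%:R)%:E]].

Definition linear_coding_capacity (R : realType) (F : finFieldType) : \bar R :=
  ereal_sup [set r | exists k n : nat,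
    [/\ (0 < k)%N, (0 < n)%N, has_linear_solution F k n
      & r = (k%:R / n%:R)%:E]].

(* Main.v *)
(** Upper bound in characteristic 3.  Write W, X, Y, Z as linear maps of the
    messages, and count errors in the rank metric: two matrices are close when
    the rank of their difference is at most a multiple of the defect n - k.
    A right-invertible k x n matrix is invertible up to one defect.  The demands
    of n9, ..., n14 say that, up to left factors attached to the messages
    (alpha, beta, gamma, delta below), every edge matrix has all its message
    blocks approximately equal.  Adding the four equations of n15 with these
    left factors makes each edge contribute three approximately equal terms,
    which cancel in characteristic 3; hence alpha is close to 0.  As alpha has
    rank at least k - 3 (n - k), this forces k <= 20 (n - k).

    Achievability.  Let each edge carry the sum of its three messages, in an
    abelian group where 3 is invertible.  Over an alphabet of q letters, one of
    q ^ k and q ^ k + 1 is coprime to 3, so k letters embed in integers modulo m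
    coprime to 3 which embed in k + 1 letters, giving the rate k / (k + 1). *)
Require Import Defs.
From mathcomp Require Import all_boot all_order all_algebra.
From mathcomp Require Import all_classical all_reals ereal.
From mathcomp Require Import zify.

Set Implicit Arguments.
Unset Strict Implicit.
Unset Printing Implicit Defensive.

Import Order.TTheory GRing.Theory Num.Theory.

Local Open Scope ring_scope.

(** * Approximate equality of matrices in the rank metric *)

Lemma mxrank_addW (F : fieldType) (m n c d : nat) (P Q : 'M[F]_(m, n)) :
  (\rank P <= c)%N -> (\rank Q <= d)%N -> (\rank (P + Q)%R <= c + d)%N.
Proof. by move=> Pc Qd; apply: leq_trans (mxrank_add _ _) _; apply: leq_add. Qed.

Definition near_mx (F : fieldType) (m n c : nat) (P Q : 'M[F]_(m, n)) : bool :=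
  (\rank (P - Q)%R <= c)%N.

Lemma near_mx_sym (F : fieldType) (m n c : nat) (P Q : 'M[F]_(m, n)) :
  near_mx c P Q -> near_mx c Q P.
Proof. by rewrite /near_mx -mxrank_opp opprB. Qed.

Lemma near_mx_trans (F : fieldType) (m n c d : nat) (P Q S : 'M[F]_(m, n)) :
  near_mx c P Q -> near_mx d Q S -> near_mx (c + d) P S.
Proof.
rewrite /near_mx => PQ QS; have -> : P - S = (P - Q) + (Q - S) by rewrite addrA subrK.
exact: mxrank_addW.
Qed.

Lemma mxrank_left_inverse (F : fieldType) (k n : nat)
    (R : 'M[F]_(k, n)) (r : 'M[F]_(n, k)) :
  R *m r = 1%:M -> \rank R = k /\ \rank r = k.
Proof.
move=> Rr; have := mxrankM_maxl R r; have := mxrankM_maxr R r.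
by rewrite Rr mxrank1; have := rank_leq_row R; have := rank_leq_col r; lia.
Qed.

(** The difference annihilates [r], which has rank [k], so Sylvester's rank inequality leaves it
    rank at most [n - k]. *)
Lemma near_mx_inverse (F : fieldType) (k n : nat)
    (R : 'M[F]_(k, n)) (r : 'M[F]_(n, k)) :
  R *m r = 1%:M -> near_mx (n - k) (r *m R) 1%:M.
Proof.
move=> Rr; have [_ rk] := mxrank_left_inverse Rr.
rewrite /near_mx; set E := _ - _.
have Er : E *m r = 0 by rewrite mulmxBl -mulmxA Rr mulmx1 mul1mx subrr.
by have := mxrank_mul_min E r; rewrite Er mxrank0 rk; lia.
Qed.

Lemma near_mx_mul_inverse (F : fieldType) (m k n : nat)
    (P : 'M[F]_(m, n)) (R : 'M[F]_(k, n)) (r : 'M[F]_(n, k)) :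
  R *m r = 1%:M -> near_mx (n - k) (P *m r *m R) P.
Proof.
move=> /near_mx_inverse; rewrite /near_mx; apply: leq_trans.
by rewrite -mulmxA -{2}[P]mulmx1 -mulmxBr mxrankM_maxr.
Qed.

Lemma near_mx_cancel (F : fieldType) (m k n c : nat) (P Q : 'M[F]_(m, n))
    (R : 'M[F]_(k, n)) (r : 'M[F]_(n, k)) :
  R *m r = 1%:M -> near_mx c (P *m r) (Q *m r) -> near_mx (c + (n - k)) P Q.
Proof.
move=> /mxrank_left_inverse[_ rk]; rewrite /near_mx.
have -> : P *m r - Q *m r = (P - Q) *m r by rewrite mulmxBl.
by have := mxrank_mul_min (P - Q) r; rewrite rk; lia.
Qed.

(* A demand node sees two edges that share two messages; proportionality of the
   two blocks on one edge is transferred to the other edge. *)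
Lemma near_mx_transfer (F : fieldType) (m k n c : nat) (S S' : 'M[F]_(m, k))
    (U U' P P' R : 'M[F]_(k, n)) (q r : 'M[F]_(n, k)) :
  R *m r = 1%:M -> U *m q = - (P *m r) -> U' *m q = - (P' *m r) ->
  near_mx c (S *m U) (S' *m U') -> near_mx (c + (n - k)) (S *m P) (S' *m P').
Proof.
move=> Rr UP UP' SU; apply: near_mx_cancel Rr _; move: SU; rewrite /near_mx.
apply: leq_trans; rewrite -mulmxBl.
suff -> : (S *m P - S' *m P') *m r = - ((S *m U - S' *m U') *m q).
  by rewrite mxrank_opp mxrankM_maxl.
by rewrite !mulmxBl -!mulmxA UP UP' !mulmxN opprB opprK addrC.
Qed.

(** Subtracting [3 P = 0] turns the sum into [(Q - P) + (S - P)]. *)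
Lemma near_mx_pchar3 (F : fieldType) (m k n c d : nat) (P Q S : 'M[F]_(m, n))
    (u : 'M[F]_(n, k)) :
  3%N \in [pchar F] -> near_mx c P Q -> near_mx d P S ->
  (\rank ((P + Q + S) *m u)%R <= c + d)%N.
Proof.
move=> F3 /near_mx_sym PQ /near_mx_sym PS; apply: leq_trans (mxrankM_maxl _ _) _.
have -> : P + Q + S = (Q - P) + (S - P).
  have PPP : P *+ 3 = 0 by rewrite -scaler_nat (pcharf0 F3) scale0r.
  apply/eqP; rewrite -subr_eq0 addrACA -opprD opprB.
  by rewrite -(addrA P) addrACA subrr addr0 -mulr2n -mulrS PPP.
exact: mxrank_addW.
Qed.

(** * The bound for linear codes in characteristic 3 *)

(** [WB] is the block of message B on edge W, and so on; [q9] and [r9] are the coefficients that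
    node n9 applies to its first and second edge. Each hypothesis compares the coefficients of one
    message in one demand. *)
Lemma nonT8_rank_bound (F : fieldType) (k n : nat)
    (WB WC WD XA XC XD YA YB YD ZA ZB ZC : 'M[F]_(k, n))
    (q9 r9 q10 r10 q11 r11 q12 q13 r13 q14 r14 w x y z : 'M[F]_(n, k)) :
  3%N \in [pchar F] ->
  [/\ XA *m r9 = 1%:M, WC *m q9 = - (XC *m r9) & WD *m q9 = - (XD *m r9)] ->
  [/\ WC *m q10 = 1%:M, YB *m r10 = - (WB *m q10) & YD *m r10 = - (WD *m q10)] ->
  [/\ YB *m r11 = 1%:M, XA *m q11 = - (YA *m r11) & XD *m q11 = - (YD *m r11)] ->
  WD *m q12 = 1%:M ->
  [/\ ZB *m r13 = 1%:M, XA *m q13 = - (ZA *m r13) & XC *m q13 = - (ZC *m r13)] ->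
  [/\ ZC *m r14 = 1%:M, YA *m q14 = - (ZA *m r14) & YB *m q14 = - (ZB *m r14)] ->
  [/\ XA *m x + YA *m y + ZA *m z = 1%:M, WB *m w + YB *m y + ZB *m z = 0,
      WC *m w + XC *m x + ZC *m z = 0 & WD *m w + XD *m x + YD *m y = 0] ->
  (k <= 20 * (n - k))%N.
Proof.
move=> F3 [XA1 WC9 WD9] [WC1 YB10 YD10] [YB1 XA11 XD11] WD1.
move=> [ZB1 XA13 XC13] [ZC1 YA14 YB14] [eA eB eC eD].
(* Normalised by [delta = 1], the other factors are read off from the D-blocks by means of the
   decoders that invert [XA], [YB] and [WC]. *)
pose alpha := XD *m r9; pose beta := YD *m r11; pose gamma := WD *m q10.
pose delta : 'M[F]_k := 1%:M; set d := (n - k)%N.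
have XAD : near_mx d (delta *m XD) (alpha *m XA).
  by rewrite mul1mx; apply/near_mx_sym/near_mx_mul_inverse.
have YBD : near_mx d (delta *m YD) (beta *m YB).
  by rewrite mul1mx; apply/near_mx_sym/near_mx_mul_inverse.
have WCD : near_mx d (delta *m WD) (gamma *m WC).
  by rewrite mul1mx; apply/near_mx_sym/near_mx_mul_inverse.
(* Each transfer adds one defect: 2d on X, Y and W. On Z, the pairs compared through D are 3d apart
   before the transfer, hence 4d after it. *)
have XCD := near_mx_transfer XA1 WD9 WC9 WCD.
have YAD := near_mx_transfer YB1 XD11 XA11 XAD.
have WBD := near_mx_transfer WC1 YD10 YB10 YBD.
have ZAC := near_mx_transfer ZB1 XA13 XC13 (near_mx_trans (near_mx_sym XAD) XCD).
have ZAB := near_mx_transfer ZC1 YA14 YB14 (near_mx_trans (near_mx_sym YAD) YBD).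
(* The n15 equations for A, B, C, D, multiplied by [alpha], [beta], [gamma], [delta], are added and
   regrouped by edge. *)
have alphaE : alpha = (delta *m XD + alpha *m XA + gamma *m XC) *m x
    + (delta *m YD + alpha *m YA + beta *m YB) *m y
    + (alpha *m ZA + beta *m ZB + gamma *m ZC) *m z
    + (delta *m WD + beta *m WB + gamma *m WC) *m w.
  have := congr1 (mulmx delta) eD; have := congr1 (mulmx gamma) eC.
  have := congr1 (mulmx beta) eB; have := congr1 (mulmx alpha) eA.
  rewrite !mulmx0 mulmx1 !mulmxDr !mulmxDl !mulmxA => hA hB hC hD.
  have := f_equal2 +%R (f_equal2 +%R (f_equal2 +%R hA hB) hC) hD.
  rewrite !addr0 => sumE; rewrite -[LHS]sumE.
  by rewrite (AC (3*3*3*3) ((11*1*8)*(12*2*5)*(3*6*9)*(10*4*7))).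
have := near_mx_pchar3 x F3 XAD XCD; have := near_mx_pchar3 y F3 YAD YBD.
have := near_mx_pchar3 z F3 ZAB ZAC; have := near_mx_pchar3 w F3 WBD WCD.
(* Three applications of Sylvester's inequality lose [d] each, along [ZC], [XC], [q9], [alpha]. *)
have rank_alpha : (k - 3 * d <= \rank alpha)%N.
  have [_ r13k] := mxrank_left_inverse ZB1; have [ZCk _] := mxrank_left_inverse ZC1.
  have [_ r9k] := mxrank_left_inverse XA1; have [WDk _] := mxrank_left_inverse WD1.
  have := mxrank_mul_min WD q9; rewrite WD9 mxrank_opp -/alpha WDk.
  have := mxrankM_maxr WC q9; rewrite WC9 mxrank_opp.
  have := mxrank_mul_min XC r9; rewrite r9k.
  have := mxrankM_maxl XC q13; rewrite XC13 mxrank_opp.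
  have := mxrank_mul_min ZC r13; rewrite r13k ZCk /d.
  lia.
(* The edges X, Y, Z, W contribute 3d + 3d + 8d + 3d = 17d; the 3d lost in [rank_alpha] make 20d. *)
move=> hW hZ hY hX; move: rank_alpha; rewrite alphaE.
move/leq_trans/(_ (mxrank_addW (mxrank_addW (mxrank_addW hX hY) hZ) hW)).
rewrite /d; lia.
Qed.

Lemma row_mulmx_inj (F : fieldType) (m n : nat) (M N : 'M[F]_(m, n)) :
  (forall v : 'rV_m, v *m M = v *m N) -> M = N.
Proof. by move=> MN; apply/row_matrixP => i; rewrite !rowE. Qed.

Lemma row_mulmx_opp (F : fieldType) (m n : nat) (M N : 'M[F]_(m, n)) :
  (forall v : 'rV_m, v *m M + v *m N = 0) -> M = - N.
Proof.
move=> MN; apply: row_mulmx_inj => v; apply/eqP.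
by rewrite mulmxN -addr_eq0 MN.
Qed.

(** Evaluating a demand with all messages but one equal to zero isolates one block equation. *)
Lemma linear_solution_pchar3 (F : fieldType) (k n : nat) :
  3%N \in [pchar F] -> has_linear_solution F k n -> (k <= 20 * (n - k))%N.
Proof.
move=> F3 [s [sol [[]]]].
move=> [WB [WC [WD hW]]] [XA [XC [XD hX]]] [YA [YB [YD hY]]] [ZA [ZB [ZC hZ]]].
move=> [[p9 [q9 [r9 h9]]] [p10 [q10 [r10 h10]]] [p11 [q11 [r11 h11]]]].
move=> [[p12 [q12 [r12 h12]]] [p13 [q13 [r13 h13]]] [p14 [q14 [r14 h14]]]].
move=> [w [x [y [z h15]]]].
have sol9 A B C D := let: And5 e _ _ _ _ := sol A B C D in e.
have sol10 A B C D := let: And5 _ e _ _ _ := sol A B C D in e.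
have sol11 A B C D := let: And5 _ _ e _ _ := sol A B C D in e.
have sol12 A B C D := let: And5 _ _ _ e _ := sol A B C D in e.
have sol13 A B C D := let: And5 _ _ _ _ (And3 e _ _) := sol A B C D in e.
have sol14 A B C D := let: And5 _ _ _ _ (And3 _ e _) := sol A B C D in e.
have sol15 A B C D := let: And5 _ _ _ _ (And3 _ _ e) := sol A B C D in e.
pose edgeE := (hW, hX, hY, hZ, h9, h10, h11, h12, h13, h14, h15).
pose simpE := (mul0mx, addr0, add0r, mulmxDr, mulmx1, mulmx0, mulmxA).
apply: (@nonT8_rank_bound F k n WB WC WD XA XC XD YA YB YD ZA ZB ZC
  q9 r9 q10 r10 q11 r11 q12 q13 r13 q14 r14 w x y z F3).
- split; [apply: row_mulmx_inj | apply: row_mulmx_opp | apply: row_mulmx_opp] => v.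
  + by have := sol9 v 0 0 0; rewrite /= !edgeE !simpE.
  + by have := sol9 0 0 v 0; rewrite /= !edgeE !simpE.
  + by have := sol9 0 0 0 v; rewrite /= !edgeE !simpE.
- split; [apply: row_mulmx_inj | apply: row_mulmx_opp | apply: row_mulmx_opp] => v.
  + by have := sol10 0 0 v 0; rewrite /= !edgeE !simpE.
  + by have := sol10 0 v 0 0; rewrite /= !edgeE !simpE addrC.
  + by have := sol10 0 0 0 v; rewrite /= !edgeE !simpE addrC.
- split; [apply: row_mulmx_inj | apply: row_mulmx_opp | apply: row_mulmx_opp] => v.
  + by have := sol11 0 v 0 0; rewrite /= !edgeE !simpE.
  + by have := sol11 v 0 0 0; rewrite /= !edgeE !simpE.
  + by have := sol11 0 0 0 v; rewrite /= !edgeE !simpE.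
- apply: row_mulmx_inj => v.
  by have := sol12 0 0 0 v; rewrite /= !edgeE !simpE.
- split; [apply: row_mulmx_inj | apply: row_mulmx_opp | apply: row_mulmx_opp] => v.
  + by have := sol13 0 v 0 0; rewrite /= !edgeE !simpE.
  + by have := sol13 v 0 0 0; rewrite /= !edgeE !simpE.
  + by have := sol13 0 0 v 0; rewrite /= !edgeE !simpE.
- split; [apply: row_mulmx_inj | apply: row_mulmx_opp | apply: row_mulmx_opp] => v.
  + by have := sol14 0 0 v 0; rewrite /= !edgeE !simpE.
  + by have := sol14 v 0 0 0; rewrite /= !edgeE !simpE.
  + by have := sol14 0 v 0 0; rewrite /= !edgeE !simpE.
- split; apply: row_mulmx_inj => v.
  + by have := sol15 v 0 0 0; rewrite /= !edgeE !simpE.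
  + by have := sol15 0 v 0 0; rewrite /= !edgeE !simpE.
  + by have := sol15 0 0 v 0; rewrite /= !edgeE !simpE.
  + by have := sol15 0 0 0 v; rewrite /= !edgeE !simpE.
Qed.

(** * Achievability by sums in an abelian group *)

Definition sum_code (V : zmodType) (T : Type) (k n : nat)
    (f : 'rV[T]_k -> V) (f' : V -> 'rV[T]_k)
    (g : V -> 'rV[T]_n) (g' : 'rV[T]_n -> V) (third : V -> V) :
  nonT8_code T k n :=
  let edge P Q S := g (f P + f Q + f S) in
  let decode P E1 E2 := f' (g' E2 - g' E1 + f P) in
  {| edgeW := edge; edgeX := edge; edgeY := edge; edgeZ := edge;
     decode9 := decode;
     decode10 := fun A W Y => decode A Y W;
     decode11 := decode;
     decode12 := fun A W Z => decode A Z W;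
     decode13 := decode;
     decode14 := decode;
     decode15 := fun W X Y Z => f' (third (g' X + g' Y + g' Z - g' W *+ 2)) |}.

(** For n9 to n14, the two edges share two messages, so their difference plus the known message is
    the demanded one. For n15, [X + Y + Z - 2 W = 3 A]. *)
Lemma sum_code_solution (V : zmodType) (T : Type) (k n : nat)
    (f : 'rV[T]_k -> V) (f' : V -> 'rV[T]_k)
    (g : V -> 'rV[T]_n) (g' : 'rV[T]_n -> V) (third : V -> V) :
  cancel f f' -> cancel g g' -> (forall v, third (v *+ 3) = v) ->
  is_solution (sum_code f f' g g' third).
Proof.
move=> fK gK third3 A B C D /=; rewrite !gK mulr2n !opprD.
split; [..|split]; rewrite -[RHS]fK; congr f'.
- by rewrite (AC (3*3*1) (1*(7*4)*(2*5)*(3*6))) /= !subrr !addr0.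
- by rewrite (AC (3*3*1) (2*(7*4)*(1*5)*(3*6))) /= !subrr !addr0.
- by rewrite (AC (3*3*1) (2*(1*4)*(7*5)*(3*6))) /= !subrr !addr0.
- by rewrite (AC (3*3*1) (3*(7*4)*(1*5)*(2*6))) /= !subrr !addr0.
- by rewrite (AC (3*3*1) (2*(1*4)*(3*5)*(7*6))) /= !subrr !addr0.
- by rewrite (AC (3*3*1) (3*(1*4)*(2*5)*(7*6))) /= !subrr !addr0.
rewrite (AC (3*3*3*(3*3))
  ((1*4*7)*(5*10)*(8*13)*(2*11)*(9*14)*(3*12)*(6*15))) /= !subrr !addr0.
by rewrite -mulr2n -mulrSr third3.
Qed.

Lemma linear_solution_rate1 (F : fieldType) (k : nat) :
  3%N \notin [pchar F] -> has_linear_solution F k k.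
Proof.
rewrite inE /= => F3; pose third (v : 'rV[F]_k) := 3%:R^-1 *: v.
exists (sum_code id id id id third); split.
  apply: sum_code_solution => // v.
  by rewrite /third -scaler_nat scalerA mulVf ?scale1r.
have lin_edge : linear3 (fun P Q S : 'rV[F]_k => P + Q + S).
  by exists 1%:M, 1%:M, 1%:M => P Q S; rewrite !mulmx1.
have lin_decode : linear3 (fun P E1 E2 : 'rV[F]_k => E2 - E1 + P).
  exists 1%:M, (- 1%:M), 1%:M => P E1 E2.
  by rewrite mulmxN !mulmx1 addrC addrA addrAC.
have lin_decode' : linear3 (fun P E2 E1 : 'rV[F]_k => E2 - E1 + P).
  exists 1%:M, 1%:M, (- 1%:M) => P E2 E1.
  by rewrite mulmxN !mulmx1 -[RHS]addrA [RHS]addrC.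
split=> //=.
exists ((- 3%:R^-1 *+ 2)%:M), (3%:R^-1)%:M, (3%:R^-1)%:M, (3%:R^-1)%:M => W X Y Z.
rewrite !mul_mx_scalar /third !scalerDr scalerN -scalerMnr -scalerMnl scaleNr mulNrn.
by rewrite (AC (3*1) (4*1*2*3)).
Qed.

Lemma retract_of_card (T U : finType) (t0 : T) :
  (#|T| <= #|U|)%N -> exists (f : T -> U) (g : U -> T), cancel f g.
Proof.
move=> le_TU; pose f (x : T) : U := enum_val (widen_ord le_TU (enum_rank x)).
have f_inj : injective f.
  by move=> x y /enum_val_inj/(congr1 val)/= /val_inj/enum_rank_inj.
(* Outside the image of [f] the retraction takes the default value [t0]. *)
exists f, (fun y => odflt t0 [pick x | f x == y]) => x.
by case: pickP => [y /eqP/f_inj // | /(_ x)]; rewrite eqxx.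
Qed.

Lemma solution_rate_succ (T : finType) (k : nat) :
  (1 < #|T|)%N -> (0 < k)%N -> has_solution T k k.+1.
Proof.
move=> T1 k0; have /card_gt0P[t0 _] : (0 < #|T|)%N by exact: ltnW.
set q := #|T| in T1; pose m := if (3 %| q ^ k)%N then (q ^ k).+1 else (q ^ k)%N.
have qk1 : (1 < q ^ k)%N by rewrite -(exp1n k) ltn_exp2r.
have m_ge : (q ^ k <= m)%N by rewrite /m; case: ifP.
have m_le : (m <= q ^ k.+1)%N by rewrite /m expnS; case: ifP => _; nia.
have m_coprime : coprime m 3.
  rewrite coprime_sym prime_coprime //= /m; case: ifP => [|-> //].
  by move=> d3; rewrite -[(q ^ k).+1]addn1 dvdn_addr.
(* ['Z_m] has exactly [m] elements only for [m > 1]. *)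
have m1 : (1 < m)%N by apply: leq_trans m_ge.
have cardZ : #|{: 'Z_m}| = m by rewrite card_ord Zp_cast.
have [||f [f' fK]] := @retract_of_card 'rV[T]_k 'Z_m.
- exact: const_mx.
- by rewrite card_mx mul1n cardZ.
have [||g [g' gK]] := @retract_of_card 'Z_m 'rV[T]_k.+1.
- exact: 0.
- by rewrite card_mx mul1n cardZ.
exists (sum_code f f' g g' (fun v => v / 3%:R)); apply: sum_code_solution => // v.
by rewrite -[v *+ 3]mulr_natr mulrK // unitZpE.
Qed.

(** * The general upper bound 1, and the capacities *)

(** With B, C, D fixed, W is constant, so n9 recovers A from X alone and the map from A to X is
    injective. *)
Lemma solution_rate_le1 (T : finType) (k n : nat) :
  (1 < #|T|)%N -> has_solution T k n -> (k <= n)%N.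
Proof.
move=> T1 [s sol]; have /card_gt0P[t0 _] : (0 < #|T|)%N by exact: ltnW.
pose v : 'rV[T]_k := const_mx t0.
have /can_inj/leq_card : cancel (fun A => edgeX s A v v)
    (decode9 s v (edgeW s v v v)).
  by move=> A; case: (sol A v v v).
by rewrite !card_mx !mul1n leq_exp2l.
Qed.

Theorem corollary4p3 (R : realType) :
  [/\ forall F : finFieldType, 3%N \in [pchar F] ->
        (linear_coding_capacity R F <= (28%:R / 29%:R)%:E)%E,
      forall F : finFieldType, 3%N \notin [pchar F] ->
        linear_coding_capacity R F = 1%:E
    & forall T : finType, (1 < #|T|)%N -> coding_capacity R T = 1%:E].
Proof.
split=> [F F3 | F F3 | T T1].
- apply: ge_ereal_sup => _ [k [n [k0 n0 sol ->]]].
  rewrite lee_fin ler_pdivrMr ?ltr0n // mulrAC ler_pdivlMr ?ltr0n //.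
  (* As [k] is positive, the truncated difference [n - k] is too, and the bound gives
     [k / n <= 20/21 < 28/29]. *)
  by rewrite -!natrM ler_nat; have := linear_solution_pchar3 F3 sol; lia.
- apply/eqP; rewrite eq_le; apply/andP; split; last first.
    apply: ereal_sup_ubound; exists 1%N, 1%N; split=> //; last by rewrite divr1.
    exact: linear_solution_rate1.
  apply: ge_ereal_sup => _ [k [n [k0 n0 [s [sol _]] ->]]].
  rewrite lee_fin ler_pdivrMr ?ltr0n // mul1r ler_nat.
  apply: (@solution_rate_le1 F); last by exists s.
  exact: card_finNzRing_gt1.
- apply/eqP; rewrite eq_le; apply/andP; split.
    apply: ge_ereal_sup => _ [k [n [k0 n0 sol ->]]].
    rewrite lee_fin ler_pdivrMr ?ltr0n // mul1r ler_nat.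
    exact: solution_rate_le1 sol.
  (* Rates approach 1: with [1 / (k + 1) < e], the positive message length [k.+1] has rate
     [1 - 1 / (k + 2)], above [1 - e]. *)
  apply/lee_subgt0Pr => e e0.
  have [k] := ltr_add_invr e0; rewrite add0r => ke.
  apply: (@le_trans _ _ (k.+1%:R / k.+2%:R)%:E); last first.
    by apply: ereal_sup_ubound; exists k.+1, k.+2; split=> //; exact: solution_rate_succ.
  rewrite -EFinB lee_fin.
  have -> : k.+1%:R / k.+2%:R = 1 - k.+2%:R^-1 :> R.
    by rewrite -[k.+2%:R]natr1 -[X in X / _](addrK 1) mulrBl mul1r divff // natr1 pnatr_eq0.
  rewrite lerD2l lerN2; apply: le_trans (ltW ke).
  by rewrite lef_pV2 ?posrE ?ltr0n // ler_nat.
Qed.
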